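(* Let $\theta=(\theta_1,\theta_2,\dots)$ be a finite or square-summable infinite sequence of real numbers, and for each $m\ge 0$ let $\theta_{U(m)}=(\theta_{m+1},\theta_{m+2},\dots)$ be the vector of unmodeled parameters when the first $m$ parameters are modeled. Then the model insufficiency contribution $\|\theta_{U(m)}\|_2^2$ to the parameter error is a nonincreasing function of $m$; precisely, it decreases by exactly $|\theta_{m+1}|^2$ when $m$ is replaced by $m+1$ (for every $m$ such that $\theta_{m+1}$ exists).
   Context: The model insufficiency operator is the identity operator $I_U$ on the space of unmodeled parameters, so its contribution to the squared parameter error is $\|I_U\theta_U\|_2^2=\|\theta_U\|_2^2$, with $\|\cdot\|_2$ the Euclidean ($\ell^2$) norm. The empty vector has norm $0$. *)

(* Defs.v *)
From mathcomp Require Import all_boot all_order all_algebra.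
From mathcomp Require Import all_classical all_reals all_analysis.
Set Implicit Arguments.
Unset Strict Implicit.
Unset Printing Implicit Defensive.
Import Order.TTheory GRing.Theory Num.Theory.
Import numFieldNormedType.Exports.
Local Open Scope ring_scope.

(* Indices are shifted by one: the entry of index [k] below is theta_(k+1). *)
Inductive param_seq (T : Type) : Type :=
| FiniteSeq of seq T
| InfiniteSeq of nat -> T.

Arguments FiniteSeq {T}.
Arguments InfiniteSeq {T}.

(* [None] when the sequence is finite and has at most [k] entries. *)
Definition entry (T : Type) (theta : param_seq T) (k : nat) : option T :=
  match theta with
  | FiniteSeq s => onth s k
  | InfiniteSeq u => Some (u k)
  end.

Definition square_summable (R : realType) (theta : param_seq R) : Prop :=
  match theta with
  | FiniteSeq _ => True
  | InfiniteSeq u => cvgn (series (fun k => `|u k| ^+ 2))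
  end.

(* Meaningful only for square-summable sequences: the limit of a divergent
   sequence is an arbitrary value. *)
Definition norm2 (R : realType) (theta : param_seq R) : R :=
  match theta with
  | FiniteSeq s => Num.sqrt (\sum_(x <- s) `|x| ^+ 2)
  | InfiniteSeq u => Num.sqrt (limn (series (fun k => `|u k| ^+ 2)))
  end.

(* (theta_(m+1), theta_(m+2), ...): the empty vector once a finite sequence is
   exhausted. *)
Definition unmodeled (T : Type) (theta : param_seq T) (m : nat) : param_seq T :=
  match theta with
  | FiniteSeq s => FiniteSeq (drop m s)
  | InfiniteSeq u => InfiniteSeq (fun k => u (m + k)%N)
  end.

(* I_U, for all the spaces of unmodeled parameters at once. *)
Definition insufficiency_operator (T : Type) : param_seq T -> param_seq T :=
  idfun.

Definition insufficiency_contribution (R : realType) (theta : param_seq R)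
    (m : nat) : R :=
  norm2 (insufficiency_operator (unmodeled theta m)) ^+ 2.

(* Main.v *)
Require Import Defs.
From mathcomp Require Import all_boot all_order all_algebra.
From mathcomp Require Import all_classical all_reals all_analysis.
Import Order.TTheory GRing.Theory Num.Theory.
Import numFieldNormedType.Exports.
Local Open Scope ring_scope.

(** Since the squared norm of a sequence is the sum of the squares of its
    entries, the squared norm of a tail is what remains of the total after the
    first entries are removed: a finite sum minus its first terms, or, for a
    square-summable infinite sequence, the limit of the series minus a partial
    sum ([lim_series_shift]). Passing from [m] to [m + 1] therefore removes
    exactly the square of one entry, or nothing once a finite sequence is
    exhausted; a square is nonnegative, so the contribution cannot increase. *)

(** The [n]-th partial sum of the shifted series is the [(n + m)]-th one of [v]
    minus the constant [series v m], and shifting the index of a sequence does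
    not change its limit. *)
Lemma lim_series_shift (R : realType) (v : nat -> R) (m : nat) :
  cvgn (series v) ->
  limn (series (fun k => v (m + k)%N)) = limn (series v) - series v m.
Proof.
move=> cv.
have -> : series (fun k => v (m + k)%N) =
    (fun n => series v (n + m)%N - series v m).
  apply/funext => n; rewrite !seriesEnat /=.
  rewrite [in RHS](@big_cat_nat _ _ _ m) ?leq_addl //= [RHS]addrC addKr.
  rewrite -[X in _ = \sum_(X <= _ < _) _]add0n big_addn addnK.
  by apply: eq_bigr => i _; rewrite addnC.
apply/cvg_lim => //; apply: cvgB; last exact: cvg_cst.
by rewrite (cvg_shiftn m (series v)).
Qed.

Lemma contribution_finite (R : realType) (s : seq R) (m : nat) :
  insufficiency_contribution (FiniteSeq s) m =
  \sum_(x <- drop m s) `|x| ^+ 2.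
Proof. by rewrite /insufficiency_contribution /= sqr_sqrtr // sumr_ge0. Qed.

(** Convergence serves twice: to subtract limits, and to bound the partial sums
    by the limit, so that the radicand in the norm is nonnegative and squaring
    undoes the square root. *)
Lemma contribution_infinite (R : realType) (u : nat -> R) (m : nat) :
  square_summable (InfiniteSeq u) ->
  insufficiency_contribution (InfiniteSeq u) m =
  limn (series (fun k => `|u k| ^+ 2)) - series (fun k => `|u k| ^+ 2) m.
Proof.
move=> /= cu; rewrite /insufficiency_contribution /=.
rewrite (lim_series_shift R (fun k => `|u k| ^+ 2)) //.
rewrite sqr_sqrtr // subr_ge0; apply: nondecreasing_cvgn_le => //.
by apply: nondecreasing_series => n _ _; exact: exprn_ge0.
Qed.

Lemma contribution_step (R : realType) (theta : param_seq R) (m : nat) (t : R) :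
  square_summable theta -> entry theta m = Some t ->
  insufficiency_contribution theta m.+1 =
  insufficiency_contribution theta m - `|t| ^+ 2.
Proof.
case: theta => [s|u] theta_l2 /=.
  move=> s_m; have ltms : (m < size s)%N by rewrite -onthTE s_m.
  rewrite !contribution_finite (drop_nth t ltms) (onth_nth _ _ _ _ s_m) big_cons.
  by rewrite [RHS]addrC addKr.
by case=> <-; rewrite !contribution_infinite // seriesSr opprD addrA.
Qed.

Lemma contribution_exhausted (R : realType) (theta : param_seq R) (m : nat) :
  entry theta m = None ->
  insufficiency_contribution theta m.+1 = insufficiency_contribution theta m.
Proof.
case: theta => [s|//] /= s_m; have lesm : (size s <= m)%N by rewrite -onthNE s_m.
by rewrite !contribution_finite !drop_oversize // ltnW.
Qed.

Theorem mainTheorem3 (R : realType) (theta : param_seq R)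
    (theta_l2 : square_summable theta) :
  nonincreasing_seq (insufficiency_contribution theta) /\
  (forall (m : nat) (t : R), entry theta m = Some t ->
     insufficiency_contribution theta m.+1 =
     insufficiency_contribution theta m - `|t| ^+ 2).
Proof.
split=> [|m t]; last exact: contribution_step.
apply/nonincreasing_seqP => m; case theta_m: (entry theta m) => [t|].
  by rewrite (contribution_step _ _ _ _ theta_l2 theta_m) gerBl exprn_ge0.
by rewrite contribution_exhausted.
Qed.
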